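(* Let $d \geq 3$ and $1 \leq r < \frac{d}{2}$ be integers, and let $\overline{B}_{d,r}(n)$ be the number of overpartitions of $n$ defined in the context. Then, as formal power series in $q$ (equivalently, for $|q|<1$), $$\sum_{n \geq 0} \overline{B}_{d,r}(n) q^n = \frac{\left(-q^r,-q^{d-r};q^d\right)_{\infty}}{\left(q^{2d};q^{2d}\right)_{\infty}}.$$
   Context: Notation: for $n \in \mathbb{N}_0 \cup \{\infty\}$, $(a_1,\dots,a_k;q)_n := \prod_{j=0}^{n-1}(1-a_1q^j)\cdots(1-a_kq^j)$. An overpartition of $n$ is a partition of $n$ (a non-decreasing sequence of positive integer parts $\lambda_1 \le \lambda_2 \le \cdots$ with sum $n$) in which the final occurrence of each integer may be overlined. Use the four symbols $\overline{r}, \overline{d-r}, \overline{d}, d$ for types of parts: a part is said to be $\equiv \overline{r}$ (resp. $\overline{d-r}$, $\overline{d}$) modulo $d$ if it is overlined and its size is congruent to $r$ (resp. $d-r$, $d$) modulo $d$; it is $\equiv d$ modulo $d$ (without overline) if it is non-overlined and its size is divisible by $d$. The same convention (overlined symbol means overlined part, non-overlined symbol means non-overlined part) applies to congruences modulo $2d$. Define the matrix $\overline{A}_{d,r}$, with rows and columns both indexed in order by $\overline{r}, \overline{d-r}, \overline{d}, d$ and with $\overline{A}_{d,r}(u,v)$ the entry in row $u$, column $v$, by $$\overline{A}_{d,r} = \begin{pmatrix} d & 2r & d+r & r \\ 2d-2r & d & 2d-r & d-r \\ 2d-r & d+r & 2d & d \\ d-r & r & d & 0 \end{pmatrix}.$$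 For $n \ge 0$, $\overline{B}_{d,r}(n)$ is the number of overpartitions $\lambda$ of $n$ into parts congruent to $r$, $d-r$, or $d$ modulo $d$, where only multiples of $d$ may appear non-overlined, such that: (i) the smallest part $\lambda_1$ is congruent to $\overline{r}$, $\overline{d-r}$, $\overline{d}$, or $2d$ modulo $2d$ (i.e. it is overlined with size congruent to $r$, $d-r$ or $d$ modulo $2d$, or non-overlined with size divisible by $2d$); (ii) for $u,v \in \{\overline{r},\overline{d-r},\overline{d},d\}$, if $\lambda_{i+1} \equiv u \pmod d$ and $\lambda_i \equiv v \pmod d$, then $\lambda_{i+1}-\lambda_i \geq \overline{A}_{d,r}(u,v)$; (iii) for $u,v$ as in (ii), if $\lambda_{i+1} \equiv u \pmod d$ and $\lambda_i \equiv v \pmod d$, then $\lambda_{i+1}-\lambda_i \equiv \overline{A}_{d,r}(u,v) \pmod{2d}$. The empty overpartition is counted, so $\overline{B}_{d,r}(0)=1$. *)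

(* Defs.v *)
From HB Require Import structures.
From mathcomp Require Import all_boot all_order all_algebra.
Set Implicit Arguments.
Unset Strict Implicit.
Unset Printing Implicit Defensive.
Import Order.TTheory GRing.Theory Num.Theory.
Local Open Scope ring_scope.

(* A formal power series in q with integer coefficients is its coefficient
   sequence; the variable q is 'X for polynomials. *)
Definition fps := nat -> int.

Definition fps_mul (f g : fps) : fps :=
  fun n => \sum_(i < n.+1) f i * g (n - i)%N.

(* The first n coefficients of 1/f, when f 0 is a unit (see fps_mulV). *)
Fixpoint fps_inv_coefs (f : fps) (n : nat) : seq int :=
  if n is m.+1 then
    let s := fps_inv_coefs f m in
    rcons s ((f 0%N)^-1 * ((m == 0%N)%:R - \sum_(i < m) s`_i * f (m - i)%N))
  else [::].

Definition fps_inv (f : fps) : fps := fun n => (fps_inv_coefs f n.+1)`_n.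

Definition fps_div (f g : fps) : fps := fps_mul f (fps_inv g).

(* Convergence in the q-adic topology: each coefficient is eventually
   constant. *)
Definition fps_cvg (u : nat -> {poly int}) (f : fps) : Prop :=
  forall k : nat, exists n0 : nat, forall n, (n0 <= n)%N -> (u n)`_k = f k.

(* (a_1, ..., a_k; x)_n, with a = [:: a_1; ...; a_k]. *)
Definition qpoch (a : seq {poly int}) (x : {poly int}) (n : nat) : {poly int} :=
  \prod_(j < n) \prod_(b <- a) (1 - b * x ^+ j).

(* f = (a_1, ..., a_k; x)_oo *)
Definition is_qpoch_inf (a : seq {poly int}) (x : {poly int}) (f : fps) : Prop :=
  fps_cvg (qpoch a x) f.

Local Open Scope nat_scope.

(* A part is a pair (size, is it overlined?); overpartitions are listed with
   the smallest part first. *)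
Definition part := (nat * bool)%type.

(* An overlined part must differ in size from all later ones. *)
Definition overpartition (n : nat) (s : seq part) : bool :=
  [&& all (fun x : part => 0 < x.1) s,
      pairwise (fun x y : part => (x.1 <= y.1) && (x.2 ==> (x.1 != y.1))) s
    & sumn [seq x.1 | x <- s] == n].

(* x is congruent modulo m to the symbol c: c.1 is the residue and c.2 tells
   whether the symbol is overlined. *)
Definition part_cong (m : nat) (x c : part) : bool :=
  (x.2 == c.2) && (x.1 == c.1 %[mod m]).

Definition symbols (d r : nat) : seq part :=
  [:: (r, true); (d - r, true); (d, true); (d, false)].

Definition symbol (d r : nat) (u : 'I_4) : part :=
  nth (0, false) (symbols d r) u.

Definition overA (d r : nat) : 'M[nat]_4 :=
  \matrix_(u < 4, v < 4) nth 0 (nth [::]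
    [:: [:: d;             2 * r; d + r;     r    ];
        [:: 2 * d - 2 * r; d;     2 * d - r; d - r];
        [:: 2 * d - r;     d + r; 2 * d;     d    ];
        [:: d - r;         r;     d;         0    ]] u) v.

Definition smallest_cond (d r : nat) (s : seq part) : bool :=
  if s is x :: _ then
    has (part_cong (2 * d) x)
        [:: (r, true); (d - r, true); (d, true); (2 * d, false)]
  else true.

(* x and y stand for the consecutive parts lambda_i and lambda_(i+1); the
   truncated difference y.1 - x.1 is exact since x.1 <= y.1. *)
Definition gap_cond (d r : nat) (x y : part) : bool :=
  [forall u : 'I_4, forall v : 'I_4,
    part_cong d y (symbol d r u) && part_cong d x (symbol d r v) ==>
      (overA d r u v <= y.1 - x.1)
      && (y.1 - x.1 == overA d r u v %[mod 2 * d])].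

Definition overB_pred (d r n : nat) (s : seq part) : bool :=
  [&& overpartition n s,
      all (fun x => has (part_cong d x) (symbols d r)) s,
      smallest_cond d r s
    & sorted (gap_cond d r) s].

Definition of_bounded (n : nat) (s : seq ('I_n.+1 * bool)) : seq part :=
  [seq (val x.1, x.2) | x <- s].

(* An overpartition of n has at most n parts, all of size at most n, so nothing
   is lost by counting bounded sequences (see overB_enum). *)
Definition overB (d r n : nat) : nat :=
  #|[set s : n.-bseq ('I_n.+1 * bool) | overB_pred d r n (of_bounded s)]|.

Lemma overpartition_size n s : overpartition n s -> size s <= n.
Proof.
case/and3P=> pos_s _ /eqP <-.
elim: s pos_s => //= x s IHs /andP[x_gt0 /IHs].
by rewrite -add1n; apply: leq_add.
Qed.

Lemma overpartition_le n s x : overpartition n s -> x \in s -> x.1 <= n.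
Proof.
case/and3P=> _ _ /eqP <-; elim: s => //= y s IHs.
rewrite inE => /orP[/eqP ->|/IHs le_x]; first exact: leq_addr.
exact: leq_trans le_x (leq_addl _ _).
Qed.

Lemma overB_enum d r n :
  exists L : seq (seq part),
    [/\ uniq L, size L = overB d r n & forall s, (s \in L) = overB_pred d r n s].
Proof.
pose A := [set s : n.-bseq ('I_n.+1 * bool) | overB_pred d r n (of_bounded s)].
have inj_f : injective (fun s : n.-bseq ('I_n.+1 * bool) => of_bounded s).
  move=> s t /inj_map eq_st; apply/val_inj/eq_st => -[i b] [j c] /= [ij ->].
  by congr pair; apply/val_inj.
exists [seq of_bounded (s : n.-bseq _) | s <- enum A]; split.
- by rewrite (map_inj_uniq inj_f) enum_uniq.
- by rewrite size_map -cardE.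
move=> s; apply/mapP/idP => [[t]|Bs].
  by rewrite mem_enum inE => Bt ->.
have ps : overpartition n s by case/and4P: Bs.
pose t : seq ('I_n.+1 * bool) := [seq (inord x.1, x.2) | x <- s].
have le_t : size t <= n by rewrite size_map; apply: overpartition_size ps.
have ts : of_bounded (Bseq le_t) = s.
  rewrite /of_bounded /= -map_comp -[RHS]map_id; apply/eq_in_map => -[a b] sx /=.
  by rewrite inordK // ltnS (overpartition_le ps sx).
by exists (Bseq le_t); rewrite ?mem_enum ?inE ts.
Qed.

Local Open Scope ring_scope.

Lemma size_fps_inv_coefs f n : size (fps_inv_coefs f n) = n.
Proof. by elim: n => //= n IHn; rewrite size_rcons IHn. Qed.

Lemma nth_fps_inv_coefs f n i :
  (i < n)%N -> (fps_inv_coefs f n)`_i = fps_inv f i.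
Proof.
elim: n => // n IHn; rewrite ltnS leq_eqVlt => /orP[/eqP -> //|lt_in].
by rewrite /= nth_rcons size_fps_inv_coefs lt_in IHn.
Qed.

Lemma fps_mulV f : f 0%N \is a GRing.unit ->
  forall n, fps_mul (fps_inv f) f n = (n == 0%N)%:R.
Proof.
move=> Uf n; rewrite /fps_mul big_ord_recr /= subnn.
rewrite {2}/fps_inv /= nth_rcons size_fps_inv_coefs ltnn eqxx mulrC mulrA.
rewrite divrr // mul1r addrC -[RHS](subrK (\sum_(i < n) fps_inv f i * f (n - i)%N)).
by congr (_ - _ + _); apply: eq_bigr => i _; rewrite nth_fps_inv_coefs.
Qed.

(* Main.v *)
(** The matrix is separable: A(u, v) = weight u + coweight v. Allow leading parts
    of size 0 (non-overlined), so that an overpartition with at most N parts is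
    a sequence of exactly N parts reached from the part 0; the condition on the
    smallest part is then the gap condition from 0. Such a sequence is a free
    choice of N symbols u and N multiples of 2d, and a choice (u, 2dk) with j
    parts after it contributes (j+1)(weight u + 2dk) + j coweight u to the sum.
    Hence the generating function factors, and summing over u, k gives
      (1 + q^(jd+r) + q^((j+1)d-r) + q^((2j+1)d)) / (1 - q^(2d(j+1)))
        = (1 + q^(jd+r)) (1 + q^(jd+d-r)) / (1 - q^(2d(j+1))). *)
Require Import Defs.
From mathcomp Require Import all_boot all_order all_algebra.
From mathcomp Require Import zify ring.
Import GRing.Theory Num.Theory.
Local Open Scope nat_scope.

(** * Separable form of the gap condition *)

Definition weight (d r : nat) (u : 'I_4) : nat := nth 0 [:: r; d - r; d; 0] u.

(** [weight] is the last column of [overA] and [coweight] its last row; their common entry is 0. *)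
Definition coweight (d r : nat) (u : 'I_4) : nat := nth 0 [:: d - r; r; d; 0] u.

Lemma overA_separable d r (u v : 'I_4) : r <= d ->
  overA d r u v = weight d r u + coweight d r v.
Proof.
move=> le_rd; rewrite mxE /weight /coweight.
by case: u => [[|[|[|[|]]]]] //= _; case: v => [[|[|[|[|]]]]] //= _; lia.
Qed.

(** Makes size plus coweight a multiple of [d], so the residue of the next part depends on its own
    symbol alone. *)
Lemma dvdn_weight_coweight d r (u : 'I_4) : r <= d ->
  d %| weight d r u + coweight d r u.
Proof.
move=> le_rd; rewrite /weight /coweight.
by case: u => [[|[|[|[|]]]]] //= _; rewrite ?addnn -?muln2 ?subnK ?subnKC // dvdn_mulr.
Qed.

Lemma part_cong_symbolE d r x (u : 'I_4) :
  part_cong d x (symbol d r u) =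
    (x.2 == (u < 3)) && (x.1 == weight d r u %[mod d]).
Proof.
rewrite /part_cong /symbol /weight.
by case: u => [[|[|[|[|]]]]] //= _; rewrite modnn mod0n.
Qed.

(** The residues [r], [d - r] and 0 are distinct modulo [d], and the overline separates the two
    symbols of residue 0. *)
Lemma symbol_inj d r x (u v : 'I_4) : 0 < r -> 2 * r < d ->
  part_cong d x (symbol d r u) -> part_cong d x (symbol d r v) -> u = v.
Proof.
move=> r_gt0 lt_rd; rewrite /part_cong /symbol.
move=> /andP[/eqP-> /eqP->] /andP[].
have rE : r %% d = r by rewrite modn_small //; lia.
have drE : (d - r) %% d = d - r by rewrite modn_small //; lia.
case: u => [[|[|[|[|]]]]] //= ?; case: v => [[|[|[|[|]]]]] //= ? _;
  rewrite ?rE ?drE ?modnn => /eqP eq_uv; apply/val_inj => //=; lia.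
Qed.

Lemma has_symbolP d r x :
  reflect (exists u : 'I_4, part_cong d x (symbol d r u))
          (has (part_cong d x) (symbols d r)).
Proof.
apply: (iffP (has_nthP (0, false))) => [[i lt_i xi]|[u xu]].
  by exists (Ordinal (lt_i : i < 4)).
by exists u.
Qed.

Definition step (d r : nat) (x y : part) : bool :=
  [&& x.1 <= y.1, x.2 ==> (x.1 != y.1) & gap_cond d r x y].

(** Uniqueness of symbols reduces the gap condition to one matrix entry. The order conditions then
    come for free, since overlined symbols have positive coweight. *)
Lemma stepP d r x y (u v : 'I_4) : 0 < r -> 2 * r < d ->
    part_cong d x (symbol d r v) -> part_cong d y (symbol d r u) ->
  reflect (exists k, y.1 = x.1 + coweight d r v + weight d r u + k * (2 * d))
          (step d r x y).
Proof.
move=> r_gt0 lt_rd xv yu.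
have le_rd : r <= d by lia.
have AE := overA_separable d r u v le_rd.
apply: (iffP and3P) => [[le_xy _ /forallP/(_ u)/forallP/(_ v)]|[k yE]].
  rewrite yu xv /= AE => /andP[le_A].
  rewrite (eqn_mod_dvd _ le_A) => /dvdnP[k kE].
  by exists k; lia.
split; first by lia.
  apply/implyP => x2; suff: 0 < coweight d r v by lia.
  move: xv; rewrite part_cong_symbolE x2 => /andP[+ _]; rewrite /coweight.
  by case: v {AE yE} => [[|[|[|[|]]]]] //= _ _; lia.
apply/forallP => u'; apply/forallP => v'; apply/implyP => /andP[yu' xv'].
rewrite -(symbol_inj _ _ _ _ _ r_gt0 lt_rd yu yu').
rewrite -(symbol_inj _ _ _ _ _ r_gt0 lt_rd xv xv') AE.
have -> : y.1 - x.1 = k * (2 * d) + (weight d r u + coweight d r v) by lia.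
by rewrite leq_addl modnMDl eqxx.
Qed.

(** * Chains as free choices of symbols and multipliers *)

Definition next_part (d r b : nat) (u : 'I_4) (k : nat) : part :=
  (b + weight d r u + k * (2 * d), u < 3).

Lemma next_part_cong d r b u k : d %| b ->
  part_cong d (next_part d r b u k) (symbol d r u).
Proof.
move=> /dvdnP[c ->]; rewrite part_cong_symbolE eqxx /= -addnA modnMDl.
by rewrite mulnA addnC modnMDl.
Qed.

(** The congruence class reveals [u], then the size reveals [k]; distinct choices thus give distinct
    chains. *)
Lemma next_part_inj d r b (u v : 'I_4) k l : 0 < r -> 2 * r < d -> d %| b ->
  next_part d r b u k = next_part d r b v l -> u = v /\ k = l.
Proof.
move=> r_gt0 lt_rd db eq_uv.
have uv : u = v.
  apply: (symbol_inj _ _ _ _ _ r_gt0 lt_rd (next_part_cong d r b u k db)).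
  by rewrite eq_uv next_part_cong.
split=> //; move: eq_uv; rewrite uv => -[] /addnI /eqP.
by rewrite eqn_pmul2r => [/eqP|]; lia.
Qed.

(* Sequences of N parts whose first part follows a part x of symbol v with
   b = x.1 + coweight v, each gap exceeding its minimum by 2dk with k < K. *)
Fixpoint chains (d r K N b : nat) : seq (seq part) :=
  if N is N'.+1 then
    [seq next_part d r b uk.1 uk.2 :: t
      | uk : 'I_4 * 'I_K <- enum {: 'I_4 * 'I_K},
        t : seq part <- chains d r K N' ((next_part d r b uk.1 uk.2).1 + coweight d r uk.1)]
  else [:: [::]].

Lemma dvdn_next_base d r x (u : 'I_4) : r <= d ->
  part_cong d x (symbol d r u) -> d %| x.1 + coweight d r u.
Proof.
move=> le_rd; rewrite part_cong_symbolE => /andP[_ /eqP xE].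
by rewrite /dvdn -modnDml xE modnDml; apply: dvdn_weight_coweight.
Qed.

Lemma chains_uniq d r K N b : 0 < r -> 2 * r < d -> d %| b ->
  uniq (chains d r K N b).
Proof.
move=> r_gt0 lt_rd; have le_rd : r <= d by lia.
elim: N b => //= N IHN b db.
apply: allpairs_uniq_dep => [||[[u k] s] [[v l] t] _ _ /=].
- exact: enum_uniq.
- move=> [u k] _; apply: IHN.
  exact: dvdn_next_base le_rd (next_part_cong d r b u k db).
- rewrite /next_part => -[e1 e2 st].
  have [] := next_part_inj d r b u v k l r_gt0 lt_rd db.
    by rewrite /next_part e1 e2.
  by move=> uv /val_inj kl; rewrite uv kl st.
Qed.

Definition total (s : seq part) : nat := sumn [seq x.1 | x <- s].

(** [stepP] turns each link into a choice of symbol and multiplier. The bound on the total keeps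
    multipliers below [K], so truncation loses nothing. *)
Lemma mem_chains d r K N x (v : 'I_4) t : 0 < r -> 2 * r < d ->
    part_cong d x (symbol d r v) -> total t < K ->
  (t \in chains d r K N (x.1 + coweight d r v)) =
    [&& size t == N, all (fun y => has (part_cong d y) (symbols d r)) t
      & path (step d r) x t].
Proof.
move=> r_gt0 lt_rd; have le_rd : r <= d by lia.
elim: N x v t => [|N IHN] x v [|y t] xv lt_tK //=.
  by apply/allpairsPdep => -[? [? []]].
have db := dvdn_next_base _ _ _ _ le_rd xv.
rewrite /total /= in lt_tK.
have lt_tK' : total t < K by rewrite /total; lia.
apply/allpairsPdep/and3P => [[[u k] [s [_ /= s_in [yE ts]]]]|].
  rewrite ts; have yu := next_part_cong d r _ u k db.
  move: s_in; rewrite -ts (IHN _ _ _ yu lt_tK') => /and3P[sz_t t_sym t_path].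
  rewrite yE; split=> //; first by rewrite t_sym andbT; apply/has_symbolP; exists u.
  rewrite t_path andbT; apply/(stepP _ _ _ _ u v) => //.
  by exists k.
move=> [sz_t /andP[/has_symbolP[u yu] t_sym] /andP[xy t_path]].
have [k kE] := stepP _ _ _ _ _ _ r_gt0 lt_rd xv yu xy.
have lt_kK : k < K.
  have : k <= k * (2 * d) by apply: leq_pmulr; lia.
  by lia.
have yE : y = next_part d r (x.1 + coweight d r v) u k.
  case: y yu kE {xy t_path lt_tK} => y1 y2; rewrite part_cong_symbolE /=.
  by move=> /andP[/eqP-> _] ->.
exists (u, Ordinal lt_kK), t; split; rewrite ?mem_enum //=; last by rewrite yE.
have -> : (x.1 + coweight d r v + weight d r u + k * (2 * d)) = y.1 by rewrite yE.
by rewrite (IHN y u) // -eqSS sz_t t_path andbT; exact: t_sym.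
Qed.

(** * Overpartitions as paths from the part 0 *)

Lemma overpartition_rel_trans :
  transitive (fun x y : part => (x.1 <= y.1) && (x.2 ==> (x.1 != y.1))).
Proof.
move=> [y c] [x b] [z e] /= /andP[le_xy xy] /andP[le_yz _].
rewrite (leq_trans le_xy le_yz) /=; apply/implyP => hb.
by move: xy; rewrite hb /=; lia.
Qed.

Lemma zero_cong d r : part_cong d (0, false) (symbol d r ord_max).
Proof. by rewrite part_cong_symbolE /weight /= eqxx. Qed.

(** The symbol of 0 has coweight 0, so a step from it fixes the size modulo [2 * d] to be a
    weight. *)
Lemma step_zero d r x : 0 < r -> 2 * r < d -> 0 < x.1 ->
    has (part_cong d x) (symbols d r) ->
  step d r (0, false) x = smallest_cond d r [:: x].
Proof.
move=> r_gt0 lt_rd x_gt0 /has_symbolP[u xu].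
have lt2 m : m <= d -> m %% (2 * d) = m by move=> ?; rewrite modn_small //; lia.
rewrite /smallest_cond.
apply/(stepP _ _ _ _ _ _ r_gt0 lt_rd (zero_cong d r) xu)/hasP => /=.
  rewrite /coweight /= => -[k].
  (* [smallest_cond] writes the last residue as [2 * d], while the weight is 0. *)
  rewrite !add0n => xE; exists ((if u == ord_max then 2 * d else weight d r u), u < 3).
    rewrite /weight; case: u {xE xu} => [[|[|[|[|]]]]] //= ?;
    by rewrite !inE ?eqxx ?orbT.
  move: xu; rewrite part_cong_symbolE => /andP[/eqP x2 _].
  rewrite /part_cong x2 eqxx /= xE addnC modnMDl.
  by case: u {xE x2} => [[|[|[|[|]]]]] //= ?; rewrite modnn mod0n.
move=> [c]; rewrite !inE /part_cong => c_in /andP[/eqP x2 /eqP x1].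
(* The bound by [d] makes the weight its own remainder modulo [2 * d], so the quotient of [x.1] is
   the multiplier. *)
have [w wE] : exists w : 'I_4, (weight d r w == c.1 %[mod 2 * d]) /\ (w < 3) = c.2
   /\ weight d r w <= d.
  case/or4P: c_in => /eqP-> /=;
   [exists (@Ordinal 4 0 isT)|exists (@Ordinal 4 1 isT)
   |exists (@Ordinal 4 2 isT)|exists (@Ordinal 4 3 isT)];
    rewrite /weight /=; repeat split => //; try lia.
  by rewrite modnn mod0n.
case: wE => /eqP wE [w2 le_w].
have xw : part_cong d x (symbol d r w).
  rewrite part_cong_symbolE x2 w2 eqxx /=.
  by rewrite -(modn_dvdm _ (dvdn_mull 2 (dvdnn d))) x1 -wE modn_dvdm // dvdn_mull.
rewrite (symbol_inj _ _ _ _ _ r_gt0 lt_rd xu xw).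
exists (x.1 %/ (2 * d)); rewrite add0n /coweight /= add0n.
by rewrite {1}(divn_eq x.1 (2 * d)) x1 -wE (lt2 _ le_w) addnC.
Qed.

Lemma overB_predE d r n s : 0 < r -> 2 * r < d ->
  overB_pred d r n s =
    [&& all (fun x => 0 < x.1) s,
        all (fun x => has (part_cong d x) (symbols d r)) s,
        path (step d r) (0, false) s & total s == n].
Proof.
move=> r_gt0 lt_rd; rewrite /overB_pred /overpartition.
(* Transitivity reduces the pairwise condition to consecutive parts. *)
rewrite -(sorted_pairwise overpartition_rel_trans) -/(total s).
case: s => [|x s]; first by rewrite /= andbT.
have stepE : step d r =2 [rel x y | ((x.1 <= y.1) && (x.2 ==> (x.1 != y.1)))
                                    && gap_cond d r x y].
  by move=> a b; rewrite /step andbA.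
have all_cons p : all p (x :: s) = p x && all p s by [].
have -> : path (step d r) (0, false) (x :: s) =
    step d r (0, false) x && path (step d r) x s by [].
rewrite (eq_path stepE) path_relI !all_cons.
(* Both sides are false unless the first part is positive and has a symbol, as [step_zero]
   demands. *)
case: (posnP x.1) => [_|x_gt0]; first by [].
case x_sym: (has (part_cong d x) (symbols d r)); last by rewrite !andFb ?andbF.
have -> : smallest_cond d r (x :: s) = step d r (0, false) x.
  by rewrite step_zero.
rewrite /sorted !andTb -!andbA; do !bool_congr.
Qed.

Lemma step_zero_zero d r : 0 < r -> 2 * r < d -> step d r (0, false) (0, false).
Proof.
move=> r_gt0 lt_rd.
by apply/(stepP _ _ _ _ _ _ r_gt0 lt_rd (zero_cong d r) (zero_cong d r)); exists 0.
Qed.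

Lemma path_step_gt0 d r x s :
  0 < x.1 -> path (step d r) x s -> all (fun y => 0 < y.1) s.
Proof.
elim: s x => //= y s IHs x x_gt0 /andP[/and3P[le_xy _ _]].
have y_gt0 := leq_trans x_gt0 le_xy.
by rewrite y_gt0 => /(IHs _ y_gt0).
Qed.

(** Sizes never decrease, so zeros come first; they are not overlined because overlined symbols have
    positive weight. *)
Lemma path_step_zeroP d r t : 0 < r -> 2 * r < d ->
    all (fun x => has (part_cong d x) (symbols d r)) t ->
    path (step d r) (0, false) t ->
  exists m s, t = nseq m (0, false) ++ s /\ all (fun x => 0 < x.1) s.
Proof.
move=> r_gt0 lt_rd; elim: t => [|y t IHt] /=; first by exists 0, [::].
move=> /andP[/has_symbolP[u yu] t_sym] /andP[zy t_path].
case: (posnP y.1) => [y0|y_gt0]; last first.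
  by exists 0, (y :: t); rewrite /= y_gt0 (path_step_gt0 _ _ _ _ y_gt0 t_path).
have yE : y = (0, false).
  have [k] := stepP _ _ _ _ _ _ r_gt0 lt_rd (zero_cong d r) yu zy.
  case: y yu y0 {zy t_path} => y1 y2 /=; rewrite part_cong_symbolE /=.
  move=> /andP[/eqP-> _] ->; rewrite /weight.
  by case: u => [[|[|[|[|]]]]] //= _; lia.
rewrite yE in t_path *.
have [m [s [-> s_pos]]] := IHt t_sym t_path.
by exists m.+1, s.
Qed.

Lemma path_nseq_cat (T : Type) (e : rel T) z m s :
  e z z -> path e z (nseq m z ++ s) = path e z s.
Proof. by move=> zz; elim: m => //= m ->; rewrite zz. Qed.

Lemma total_nseq_cat m b s : total (nseq m (0, b) ++ s) = total s.
Proof. by elim: m. Qed.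

Lemma filter_nseq_cat m b s : all (fun x : part => 0 < x.1) s ->
  [seq x <- nseq m (0, b) ++ s | 0 < x.1] = s.
Proof. by move=> /all_filterP s_pos; elim: m. Qed.

Lemma all_nseq_cat (T : Type) (a : pred T) m z s :
  a z -> all a (nseq m z ++ s) = all a s.
Proof. by move=> az; rewrite all_cat all_nseq az orbT. Qed.

Lemma size_le_total s : all (fun x : part => 0 < x.1) s -> size s <= total s.
Proof.
elim: s => //= x s IHs /andP[x_gt0 /IHs]; rewrite /total /=; lia.
Qed.

(** Padding with leading zeros to length [N] is a bijection onto the chains of total [n], since
    there are at most [n] positive parts. *)
Lemma overB_chains d r n N : 0 < r -> 2 * r < d -> n <= N ->
  overB d r n = count (fun t => total t == n) (chains d r n.+1 N 0).
Proof.
move=> r_gt0 lt_rd le_nN.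
have [L [L_uniq <- L_mem]] := overB_enum d r n.
pose z : part := (0, false).
have z_sym : has (part_cong d z) (symbols d r).
  by apply/has_symbolP; exists ord_max; apply: zero_cong.
have zz : step d r z z by apply: step_zero_zero.
pose pad (s : seq part) := nseq (N - size s) z ++ s.
have pad_inj : {in L &, injective pad}.
  move=> s t; rewrite !L_mem !overB_predE // => /andP[s_pos _] /andP[t_pos _].
  by move=> /(congr1 (filter (fun x => 0 < x.1))); rewrite !filter_nseq_cat.
rewrite -(size_map pad) -size_filter; apply/perm_size/uniq_perm.
- by rewrite map_inj_in_uniq.
- by apply/filter_uniq/chains_uniq.
move=> t; rewrite mem_filter; apply/mapP/andP => [[s]|[/eqP t_n]].
  rewrite L_mem overB_predE // => /and4P[s_pos s_sym s_path /eqP s_n] ->.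
  have sz_s := size_le_total _ s_pos.
  rewrite total_nseq_cat s_n; split=> //.
  rewrite (mem_chains d r n.+1 N z ord_max) ?zero_cong ?total_nseq_cat ?s_n //.
  rewrite size_cat size_nseq subnK ?eqxx; last by lia.
  by rewrite all_nseq_cat // s_sym path_nseq_cat.
rewrite (mem_chains d r n.+1 N z ord_max) ?zero_cong ?t_n //.
move=> /and3P[/eqP t_N t_sym t_path].
have [m [s [tE s_pos]]] := path_step_zeroP d r t r_gt0 lt_rd t_sym t_path.
move: t_n t_N t_sym t_path; rewrite tE total_nseq_cat size_cat size_nseq.
rewrite all_nseq_cat // path_nseq_cat // => s_n t_N s_sym s_path.
exists s; last by rewrite /pad -t_N addnK.
by rewrite L_mem overB_predE // s_pos s_sym s_path s_n eqxx.
Qed.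

(** * Generating function of chains *)

Local Open Scope ring_scope.

(** In the expanded product, overlined [r] and [d - r] pick one monomial each, overlined [d] picks
    both and plain [d] neither. *)
Lemma sum_weights d r N : (r <= d)%N ->
  \sum_(u < 4) 'X^(N.+1 * weight d r u + N * coweight d r u) =
    \prod_(b <- [:: - 'X^r; - 'X^(d - r)]) (1 - b * 'X^d ^+ N) :> {poly int}.
Proof.
move=> /subnKC; set e := (d - r)%N => dE.
rewrite !big_ord_recl big_ord0 !big_cons big_nil /weight /coweight /= -/e.
rewrite -dE -!exprM !mulnDl !mulnDr !muln0 !mulSn (mulnC r N) (mulnC e N) !exprD.
ring.
Qed.

(** Induction on [N]: the base enters all [N] parts, hence the prefactor, and the first choice
    shifts the base of the rest by its weight, coweight and multiple of [2 * d]. *)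
Lemma sum_chains d r K N b : (r <= d)%N ->
  \sum_(t <- chains d r K N b) 'X^(total t) =
    'X^(N * b) * (qpoch [:: - 'X^r; - 'X^(d - r)] 'X^d N
                  * \prod_(j < N) \sum_(k < K) 'X^(2 * d * j.+1) ^+ k)
  :> {poly int}.
Proof.
move=> le_rd; elim: N b => [|N IHN] b.
  by rewrite /= big_seq1 /qpoch !big_ord0 !mulr1.
rewrite /= big_allpairs_dep big_enum /=.
rewrite /qpoch !big_ord_recr /= -/(qpoch _ _ N) -sum_weights //.
set G := qpoch _ _ N in IHN *; set H := \prod_(j < N) _ in IHN *.
transitivity (\sum_(uk : 'I_4 * 'I_K) 'X^(N.+1 * b) * (G * H) *
    ('X^(N.+1 * weight d r uk.1 + N * coweight d r uk.1)
     * ('X^(2 * d * N.+1) ^+ uk.2)) : {poly int}).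
  apply: eq_bigr => -[u k] _ /=.
  under eq_bigr => t _ do rewrite /total /= exprD -/(total t).
  rewrite -mulr_sumr IHN mulrA -exprM -!exprD.
  rewrite [in RHS]mulrAC -!exprD; congr ('X^_ * _); lia.
rewrite -mulr_sumr.
rewrite -(pair_bigA _ (fun (u : 'I_4) (k : 'I_K) =>
  'X^(N.+1 * weight d r u + N * coweight d r u)
     * ('X^(2 * d * N.+1) ^+ k) : {poly int})) /=.
under eq_bigr => u _ do rewrite -mulr_sumr.
rewrite -mulr_suml; ring.
Qed.

(** * Truncated series and infinite products *)

(* Congruence modulo 'X^n.+1. *)
Definition eqp_upto (n : nat) (p q : {poly int}) : Prop :=
  forall i, (i <= n)%N -> p`_i = q`_i.

Lemma eqp_uptoM n p q p' q' :
  eqp_upto n p q -> eqp_upto n p' q' -> eqp_upto n (p * p') (q * q').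
Proof.
move=> pq pq' i le_in; rewrite !coefM; apply: eq_bigr => j _.
by rewrite pq ?pq' //; have := ltn_ord j; lia.
Qed.

Lemma eqp_upto_prod1 n N (F : nat -> {poly int}) :
  (forall j, (j < N)%N -> eqp_upto n (F j) 1) -> eqp_upto n (\prod_(j < N) F j) 1.
Proof.
elim: N => [|N IHN] F1; first by rewrite big_ord0.
rewrite big_ord_recr /= -[X in eqp_upto _ _ X]mulr1; apply: eqp_uptoM; last exact: F1.
by apply: IHN => j lt_jN; apply: F1; apply: ltnW.
Qed.

Lemma eqp_upto1MXn n m (b : {poly int}) :
  (n < m)%N -> eqp_upto n (1 - b * 'X^m) 1.
Proof. by move=> lt_nm i le_in; rewrite coefB coefMXn (leq_ltn_trans le_in lt_nm) subr0. Qed.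

(** Factors of index at least [n] are 1 modulo ['X^k.+1], as [m * n] is at least [n > k]. *)
Lemma qpoch_stable a m n N k : (0 < m)%N -> (k < n)%N -> (n <= N)%N ->
  (qpoch a 'X^m N)`_k = (qpoch a 'X^m n)`_k.
Proof.
move=> m_gt0 lt_kn /subnKC <-; rewrite /qpoch big_split_ord /=.
rewrite -[in RHS](mulr1 (\prod_(j < n) _)).
apply: (eqp_uptoM k) (leqnn k) => //.
apply: (eqp_upto_prod1 k _ (fun j => \prod_(b <- a) (1 - b * 'X^m ^+ (n + j)))).
move=> j _; elim: a => [|b a IHa]; first by rewrite big_nil.
rewrite big_cons -[X in eqp_upto _ _ X]mulr1; apply: eqp_uptoM IHa.
rewrite -exprM; apply: eqp_upto1MXn.
apply: leq_trans (leq_pmull _ m_gt0); lia.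
Qed.

Lemma qpoch_inf a m : (0 < m)%N ->
  is_qpoch_inf a 'X^m (fun k => (qpoch a 'X^m k.+1)`_k).
Proof. by move=> m_gt0 k; exists k.+1 => n le_kn; apply: qpoch_stable. Qed.

(** Each geometric sum telescopes against its factor to [1 - 'X^(m * j.+1 * n.+1)], whose exponent
    exceeds [n]. *)
Lemma geometric_qpoch n m N : (0 < m)%N ->
  eqp_upto n (qpoch [:: 'X^m] 'X^m N
    * \prod_(j < N) \sum_(k < n.+1) 'X^(m * j.+1) ^+ k) 1.
Proof.
move=> m_gt0; rewrite /qpoch -big_split /=.
apply: (eqp_upto_prod1 n _ (fun j => \prod_(b <- [:: 'X^m]) (1 - b * 'X^m ^+ j) *
  \sum_(k < n.+1) 'X^(m * j.+1) ^+ k)) => j _.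
rewrite big_seq1 -exprS -exprM -opprB mulNr -subrX1 opprB -exprM.
rewrite -[X in 1 - X]mul1r; apply: eqp_upto1MXn.
apply: leq_trans (leq_pmull _ _) => //; lia.
Qed.

(** Uniqueness of inverses: with [v] the truncation of [fps_inv f], both [h] and [v] agree with
    [v * q * h] modulo ['X^n.+1]. *)
Lemma fps_inv_unique n (f : fps) (q h : {poly int}) :
    (forall i, (i <= n)%N -> q`_i = f i) -> eqp_upto n (q * h) 1 ->
  forall i, (i <= n)%N -> h`_i = fps_inv f i.
Proof.
move=> qf qh1.
have Uf : f 0%N \is a GRing.unit.
  by apply/unitrPr; exists h`_0; rewrite -qf // -coef0M qh1 // coef1.
pose v := \poly_(i < n.+1) fps_inv f i.
have vq1 : eqp_upto n (v * q) 1.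
  move=> i le_in; rewrite coefM coef1 -(fps_mulV Uf); apply: eq_bigr => j _.
  have lt_ji := ltn_ord j.
  rewrite coef_poly ifT ?qf //; lia.
move=> i le_in.
have -> : fps_inv f i = (v * 1)`_i by rewrite mulr1 coef_poly ltnS le_in.
rewrite -[h]mul1r -(eqp_uptoM n v v _ _ (fun _ _ => erefl) qh1) // mulrA.
exact/esym/(eqp_uptoM n _ _ h h vq1).
Qed.

(** * Comparison of coefficients *)

Lemma overB_coef d r n : (0 < r)%N -> (2 * r < d)%N ->
  (overB d r n)%:Z = (qpoch [:: - 'X^r; - 'X^(d - r)] 'X^d n.+1
    * \prod_(j < n.+1) \sum_(k < n.+1) 'X^(2 * d * j.+1) ^+ k)`_n.
Proof.
(* Length [n.+1] rather than [n] lets [qpoch_stable] reach coefficient [n]. *)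
move=> r_gt0 lt_rd; rewrite (overB_chains d r n n.+1) //.
have le_rd : (r <= d)%N by lia.
have := sum_chains d r n.+1 n.+1 0 le_rd; rewrite muln0 mul1r => <-.
rewrite coef_sum -sum1_count big_mkcond -natz natr_sum; apply: eq_bigr => t _.
by rewrite coefXn eq_sym; case: eqP.
Qed.

Theorem theorem1p1 (d r : nat) (hd : (3 <= d)%N) (hr : (1 <= r)%N)
    (hrd : (2 * r < d)%N) :
  exists P Q : fps,
    [/\ is_qpoch_inf [:: - 'X^r; - 'X^(d - r)] 'X^d P,
        is_qpoch_inf [:: 'X^(2 * d)] 'X^(2 * d) Q
      & forall n : nat, (overB d r n)%:Z = fps_div P Q n].
Proof.
have d_gt0 : (0 < d)%N by lia.
have d2_gt0 : (0 < 2 * d)%N by lia.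
pose a : seq {poly int} := [:: - 'X^r; - 'X^(d - r)].
pose b : seq {poly int} := [:: 'X^(2 * d)].
exists (fun k => (qpoch a 'X^d k.+1)`_k), (fun k => (qpoch b 'X^(2 * d) k.+1)`_k).
split=> [||n]; [exact: qpoch_inf | exact: qpoch_inf |].
rewrite overB_coef // coefM; apply: eq_bigr => i _.
have lt_in := ltn_ord i.
rewrite (qpoch_stable a d i.+1) //; congr (_ * _).
(* The product of truncated geometric sums inverts the denominator up to degree [n]. *)
apply: (fps_inv_unique n _ (qpoch b 'X^(2 * d) n.+1)); last exact: leq_subr.
  by move=> j le_jn; apply: qpoch_stable.
exact: geometric_qpoch.
Qed.
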